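(* Let $n\ge 1$ and $m\ge 1$. Every $n$-qubit unitary computed by a circuit of the layered form $(\text{-P-C-})^m=\text{-P-C-P-C-}\cdots\text{-P-C-}$ ($m$ repetitions of a -P- layer followed by a -C- layer) can also be computed by a three-stage circuit of the form -P-CZ-C-, i.e., a -P- layer followed by a -CZ- layer followed by a -C- layer.
   Context: All circuits act on $n$ qubits, with computational basis $|x_1x_2\dots x_n\rangle$, $x_j\in\{0,1\}$. The Phase gate is $\mathrm{P}=\mathrm{diag}(1,i)$; the controlled-NOT gate $\mathrm{CNOT}(a;b)$ maps basis states by $b\mapsto a\oplus b$; the controlled-$Z$ gate is $\mathrm{CZ}=\mathrm{diag}(1,1,1,-1)$. Gates may act on any qubit (resp. any pair of distinct qubits). A -P- layer is any unitary computable by a circuit of $\mathrm{P}$ gates only; a -C- layer is any unitary computable by a circuit of $\mathrm{CNOT}$ gates only; a -CZ- layer is any unitary computable by a circuit of $\mathrm{CZ}$ gates only (the identity is allowed in each case). A layered expression such as -P-CZ-C- denotes circuits obtained by performing, in order from left to right (leftmost first), one layer of each indicated type. *)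

(* Defs.v *)
(* MathComp; MathComp-Analysis is used only for the type of real numbers. *)
From mathcomp Require Import all_boot all_order all_algebra.
From mathcomp Require Import complex reals.

Set Implicit Arguments.
Unset Strict Implicit.
Unset Printing Implicit Defensive.

Import GRing.Theory.
Local Open Scope ring_scope.

Notation bits n := {ffun 'I_n -> bool}.

(* Operators on n qubits are matrices whose rows and columns are indexed by the
   computational basis through its enumeration; the entry at (i, j) is
   <x| U |y> with x = enum_val i and y = enum_val j. *)
Notation qop R n := 'M[R[i]]_#|bits n|.

Definition op_of_entries (R : realType) (n : nat)
    (F : bits n -> bits n -> R[i]) : qop R n :=
  \matrix_(i, j) F (enum_val i) (enum_val j).

Definition agree_off (n : nat) (A : {set 'I_n}) (x y : bits n) : bool :=
  [forall k, (k \notin A) ==> (x k == y k)].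

(* u acting on one qubit (resp. on the ordered pair a, b of qubits), tensored
   with the identity on the others; the rows and columns of a two-qubit matrix
   are listed in the order |00>, |01>, |10>, |11>. *)
Definition on_qubit (R : realType) (n : nat) (u : 'M[R[i]]_2) (a : 'I_n) :
    qop R n :=
  op_of_entries (fun x y =>
    u (inord (x a)) (inord (y a)) *+ agree_off [set a] x y).

Definition on_qubits (R : realType) (n : nat) (u : 'M[R[i]]_4) (a b : 'I_n) :
    qop R n :=
  op_of_entries (fun x y =>
    u (inord ((x a).*2 + x b)%N) (inord ((y a).*2 + y b)%N)
      *+ agree_off [set a; b] x y).

Definition P_mx (R : realType) : 'M[R[i]]_2 :=
  diag_mx (\row_(j < 2) [:: 1; 'i%C]`_j).

Definition CZ_mx (R : realType) : 'M[R[i]]_4 :=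
  diag_mx (\row_(j < 4) [:: 1; 1; 1; -1]`_j).

Definition cnot_bits (n : nat) (a b : 'I_n) (x : bits n) : bits n :=
  [ffun k => if k == b then x a (+) x b else x k].

Definition P_gate (R : realType) (n : nat) (g : qop R n) : Prop :=
  exists a : 'I_n, g = on_qubit (P_mx R) a.

Definition CZ_gate (R : realType) (n : nat) (g : qop R n) : Prop :=
  exists a b : 'I_n, a != b /\ g = on_qubits (CZ_mx R) a b.

Definition CNOT_gate (R : realType) (n : nat) (g : qop R n) : Prop :=
  exists a b : 'I_n, a != b /\
    g = op_of_entries (fun x y => (x == cnot_bits a b y)%:R).

(* The head of the list is performed first, hence is the rightmost factor. *)
Fixpoint circuit_op (R : realType) (n : nat) (s : seq (qop R n)) : qop R n :=
  if s is g :: s' then circuit_op s' *m g else 1%:M.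

Definition layer (R : realType) (n : nat) (G : qop R n -> Prop)
    (U : qop R n) : Prop :=
  exists s : seq (qop R n), {in s, forall g, G g} /\ U = circuit_op s.

Definition P_layer (R : realType) (n : nat) : qop R n -> Prop :=
  layer (@P_gate R n).

Definition CZ_layer (R : realType) (n : nat) : qop R n -> Prop :=
  layer (@CZ_gate R n).

Definition C_layer (R : realType) (n : nat) : qop R n -> Prop :=
  layer (@CNOT_gate R n).

(* U is computed by performing one layer of each listed type, the head of the
   list first. *)
Fixpoint layered (R : realType) (n : nat) (Ls : seq (qop R n -> Prop))
    (U : qop R n) : Prop :=
  if Ls is L :: Ls' then
    exists V W : qop R n, [/\ L V, layered Ls' W & U = W *m V]
  else U = 1%:M.

(* Main.v *)
(* A phase diag(f) can be moved across a CNOT circuit at the cost of replacing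
   f by its composition with the induced map on bits. Phases that are products
   of i^(x_a) and (-1)^(x_a x_b) are stable under this substitution, because
     i^(x_a + x_b mod 2) = i^(x_a) i^(x_b) (-1)^(x_a x_b)  and
     (-1)^((x_a + x_b) x_c) = (-1)^(x_a x_c) (-1)^(x_b x_c),
   where (-1)^(x_a x_a) = (i^(x_a))^2. Hence all the phases of a (-P-C-)^m
   circuit can be moved to its beginning, where they form a -P-CZ- circuit. *)
Require Import Defs.
From mathcomp Require Import all_boot all_order all_algebra.
From mathcomp Require Import complex reals.

Set Implicit Arguments.
Unset Strict Implicit.
Unset Printing Implicit Defensive.

Import GRing.Theory.

Section Layers.
Local Open Scope ring_scope.
Variables (R : realType) (n : nat).
Implicit Types (U V W c g : qop R n) (G : qop R n -> Prop) (f : bits n -> R[i]).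

Lemma circuit_op_cat (s t : seq (qop R n)) :
  circuit_op (s ++ t) = circuit_op t *m circuit_op s.
Proof. by elim: s => [|g s IH] /=; rewrite ?mulmx1 // IH mulmxA. Qed.

Lemma layer_id G : layer G 1%:M.
Proof. by exists [::]. Qed.

Lemma layer_gate G g : G g -> layer G g.
Proof.
move=> Gg; exists [:: g]; split; last by rewrite /= mul1mx.
by move=> h; rewrite inE => /eqP ->.
Qed.

Lemma layer_mul G V W : layer G V -> layer G W -> layer G (W *m V).
Proof.
move=> [s [Gs ->]] [t [Gt ->]]; exists (s ++ t).
split; last by rewrite circuit_op_cat.
by move=> g; rewrite mem_cat => /orP[/Gs|/Gt].
Qed.

(** Lets diagonality, and later the commutation past CNOT circuits, be checked gate by gate. *)
Lemma layer_ind G (Q : qop R n -> Prop) :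
    Q 1%:M -> (forall g, G g -> Q g) ->
    (forall V W, Q V -> Q W -> Q (W *m V)) ->
  forall U, layer G U -> Q U.
Proof.
move=> Q1 QG QM _ [s [Gs ->]]; elim: s Gs => [|g s IH] Gs //=.
apply: QM; first by apply/QG/Gs; rewrite mem_head.
by apply: IH => h hs; apply: Gs; rewrite inE hs orbT.
Qed.

Definition diag_op f : qop R n := diag_mx (\row_j f (enum_val j)).

Definition diagonal U := exists f, U = diag_op f.

Lemma eq_diag_op f1 f2 : f1 =1 f2 -> diag_op f1 = diag_op f2.
Proof. by move=> eqf; congr diag_mx; apply/rowP => j; rewrite !mxE eqf. Qed.

Lemma diag_op1 : diag_op (fun=> 1) = 1%:M.
Proof. by apply/matrixP => i j; rewrite !mxE. Qed.

Lemma diag_opM f1 f2 :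
  diag_op f1 *m diag_op f2 = diag_op (fun x => f1 x * f2 x).
Proof.
by rewrite /diag_op mulmx_diag; congr diag_mx; apply/rowP => j; rewrite !mxE.
Qed.

Lemma diagonalC U V : diagonal U -> diagonal V -> U *m V = V *m U.
Proof.
move=> [f ->] [g ->]; rewrite !diag_opM.
by apply: eq_diag_op => x; rewrite mulrC.
Qed.

Lemma diagonal_layer G U :
  (forall g, G g -> diagonal g) -> layer G U -> diagonal U.
Proof.
move=> dG; apply: layer_ind => //; first by exists (fun=> 1); rewrite diag_op1.
by move=> V W [f ->] [g ->]; rewrite diag_opM; eexists.
Qed.

Lemma diag_op_entries f (F : bits n -> bits n -> R[i]) :
    (forall x y, F x y = f x *+ (x == y)) ->
  op_of_entries F = diag_op f.
Proof.
by move=> FE; apply/matrixP => i j; rewrite !mxE FE (inj_eq enum_val_inj).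
Qed.

(** [agree_off] controls the positions outside [A], so agreement on [A] leaves only full equality.
    This turns gate matrices into diagonal ones. *)
Lemma agree_off_eq (A : {set 'I_n}) (x y : bits n) :
  {in A, x =1 y} -> agree_off A x y = (x == y).
Proof.
move=> eqA; apply/forallP/eqP => [eqC | -> k]; last by rewrite eqxx implybT.
apply/ffunP => k; case: (boolP (k \in A)) => [/eqA // | kA].
by have := eqC k; rewrite kA => /eqP.
Qed.

Definition P_phase (a : 'I_n) (x : bits n) : R[i] := if x a then 'i%C else 1.

Definition CZ_phase (a b : 'I_n) (x : bits n) : R[i] :=
  if x a && x b then -1 else 1.

Lemma on_qubit_P a : on_qubit (P_mx R) a = diag_op (P_phase a).
Proof.
apply: diag_op_entries => x y; rewrite !mxE.
case: (eqVneq (x a) (y a)) => [eqa | neqa].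
  rewrite agree_off_eq; last by move=> k /set1P ->.
  by rewrite eqa eqxx /P_phase eqa; case: (y a); rewrite inordK.
have /negPf -> : x != y by apply: contraNneq neqa => ->.
(* Different bits at [a] select an off-diagonal entry of [P_mx], which is zero. *)
by rewrite -val_eqE /= !inordK; case: (x a) (y a) neqa => -[]; rewrite ?mul0rn.
Qed.

Lemma on_qubits_CZ a b : on_qubits (CZ_mx R) a b = diag_op (CZ_phase a b).
Proof.
apply: diag_op_entries => x y; rewrite !mxE.
case: (boolP ((x a == y a) && (x b == y b))) => [/andP[/eqP eqa /eqP eqb] | neqab].
  rewrite agree_off_eq; last by move=> k /set2P[] ->.
  rewrite eqa eqb eqxx /CZ_phase eqa eqb.
  by case: (y a) (y b) => -[]; rewrite inordK.
have /negPf -> : x != y by apply: contraNneq neqab => ->; rewrite !eqxx.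
(* The index [2 x_a + x_b] determines both bits, so the entry is again off-diagonal. *)
rewrite -val_eqE /= !inordK; move: (x a) (y a) (x b) (y b) neqab;
  by do 4!case; rewrite ?mul0rn.
Qed.

Lemma diagonal_P_gate g : P_gate g -> diagonal g.
Proof. by move=> [a ->]; rewrite on_qubit_P; eexists. Qed.

Lemma diagonal_CZ_gate g : CZ_gate g -> diagonal g.
Proof. by move=> [a [b [_ ->]]]; rewrite on_qubits_CZ; eexists. Qed.

Definition P_CZ U := exists V W, [/\ P_layer V, CZ_layer W & U = W *m V].

Lemma P_CZ_of_P U : P_layer U -> P_CZ U.
Proof. by exists U, 1%:M; rewrite mul1mx; split=> //; apply: layer_id. Qed.

Lemma P_CZ_of_CZ U : CZ_layer U -> P_CZ U.
Proof. by exists 1%:M, U; rewrite mulmx1; split=> //; apply: layer_id. Qed.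

(** The first CZ layer and the second P layer are both diagonal, so they can be swapped. *)
Lemma P_CZ_mul U1 U2 : P_CZ U1 -> P_CZ U2 -> P_CZ (U2 *m U1).
Proof.
move=> [V1 [W1 [PV1 ZW1 ->]]] [V2 [W2 [PV2 ZW2 ->]]].
exists (V2 *m V1), (W2 *m W1); split; try exact: layer_mul.
rewrite !mulmxA; congr (_ *m _); rewrite -!mulmxA; congr (_ *m _).
by apply: diagonalC; [apply: diagonal_layer diagonal_P_gate PV2
                     |apply: diagonal_layer diagonal_CZ_gate ZW1].
Qed.

Lemma P_CZ_P_phase a : P_CZ (diag_op (P_phase a)).
Proof. by apply/P_CZ_of_P/layer_gate; exists a; rewrite on_qubit_P. Qed.

Lemma CZ_phase_id a x : CZ_phase a a x = P_phase a x * P_phase a x.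
Proof.
by rewrite /CZ_phase /P_phase andbb; case: (x a); rewrite ?mulr1 // -expr2 sqr_i.
Qed.

(** The case [a = b] arises when a CZ acts on both qubits of the CNOT being crossed; the phase is
    then P applied twice. *)
Lemma P_CZ_CZ_phase a b : P_CZ (diag_op (CZ_phase a b)).
Proof.
have [-> | neq_ab] := eqVneq a b.
  rewrite (eq_diag_op (CZ_phase_id b)) -diag_opM.
  by apply: P_CZ_mul; apply: P_CZ_P_phase.
by apply/P_CZ_of_CZ/layer_gate; exists a, b; rewrite on_qubits_CZ.
Qed.

Lemma P_phase_cnot s t a x :
  P_phase a (cnot_bits s t x) =
    if a == t then CZ_phase s t x * (P_phase s x * P_phase t x)
    else P_phase a x.
Proof.
rewrite /P_phase /CZ_phase /cnot_bits ffunE; case: eqP => [_ | //].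
case: (x s) (x t) => -[] /=; rewrite ?mul1r ?mulr1 //.
(* Both bits are 1: their sum is 0, and the sign cancels [i * i = -1]. *)
by rewrite -expr2 sqr_i mulrNN mulr1.
Qed.

(** As [a != b], at most one of the two bits is the target [t], so the exponent [x_a x_b] is
    expanded linearly in that bit alone. *)
Lemma CZ_phase_cnot s t a b x : a != b ->
  CZ_phase a b (cnot_bits s t x) =
    if a == t then CZ_phase s b x * CZ_phase t b x
    else if b == t then CZ_phase a s x * CZ_phase a t x
    else CZ_phase a b x.
Proof.
rewrite /CZ_phase /cnot_bits !ffunE => neq_ab.
case: (eqVneq a t) neq_ab => [-> | _ _]; last case: (b == t) => //.
  rewrite eq_sym => /negPf ->.
  by case: (x s) (x t) (x b) => -[] -[]; rewrite /= ?mulrNN ?mulr1 ?mul1r.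
by case: (x s) (x t) (x a) => -[] -[]; rewrite /= ?mulrNN ?mulr1 ?mul1r.
Qed.

(** Products are performed right to left: [U] after [c] becomes [U'] before [c]. *)
Definition pushes c U := exists2 U', P_CZ U' & U *m c = c *m U'.

Lemma pushes_mul c V W : pushes c V -> pushes c W -> pushes c (W *m V).
Proof.
move=> [V' dV' eqV] [W' dW' eqW]; exists (W' *m V'); first exact: P_CZ_mul.
by rewrite -mulmxA eqV mulmxA eqW mulmxA.
Qed.

Lemma pushes_id c : pushes c 1%:M.
Proof.
by exists 1%:M; [apply/P_CZ_of_P/layer_id | rewrite mul1mx mulmx1].
Qed.

(** Column [y] of [c] has its only nonzero entry in row [cnot_bits s t y], so scaling that row by
    [f] amounts to scaling the column by [f (cnot_bits s t y)]. *)
Lemma diag_op_cnot f s t :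
  let c := op_of_entries (fun x y => (x == cnot_bits s t y)%:R) in
  diag_op f *m c = c *m diag_op (fun x => f (cnot_bits s t x)).
Proof.
rewrite /diag_op mul_diag_mx mul_mx_diag; apply/matrixP => i j; rewrite !mxE.
by case: eqP => [<- | _]; rewrite mulrC // !(mul0r, mulr0).
Qed.

Lemma pushes_P_gate c g : CNOT_gate c -> P_gate g -> pushes c g.
Proof.
move=> [s [t [_ ->]]] [a ->]; rewrite on_qubit_P.
exists (diag_op (fun x => P_phase a (cnot_bits s t x))); last exact: diag_op_cnot.
rewrite (eq_diag_op (P_phase_cnot s t a)).
case: eqP => [_ | _]; last exact: P_CZ_P_phase.
rewrite -!diag_opM; apply: P_CZ_mul; last exact: P_CZ_CZ_phase.
by apply: P_CZ_mul; apply: P_CZ_P_phase.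
Qed.

Lemma pushes_CZ_gate c g : CNOT_gate c -> CZ_gate g -> pushes c g.
Proof.
move=> [s [t [_ ->]]] [a [b [neq_ab ->]]]; rewrite on_qubits_CZ.
exists (diag_op (fun x => CZ_phase a b (cnot_bits s t x))); last exact: diag_op_cnot.
rewrite (eq_diag_op (fun x => CZ_phase_cnot s t x neq_ab)).
case: eqP => [_ | _]; last case: eqP => [_ | _]; last exact: P_CZ_CZ_phase.
  by rewrite -diag_opM; apply: P_CZ_mul; apply: P_CZ_CZ_phase.
by rewrite -diag_opM; apply: P_CZ_mul; apply: P_CZ_CZ_phase.
Qed.

Lemma pushes_CNOT_gate c U : CNOT_gate c -> P_CZ U -> pushes c U.
Proof.
move=> Cc [V [W [PV ZW ->]]]; apply: pushes_mul.
  apply: layer_ind PV; [exact: pushes_id | | exact: pushes_mul].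
  by move=> g; apply: pushes_P_gate.
apply: layer_ind ZW; [exact: pushes_id | | exact: pushes_mul].
by move=> g; apply: pushes_CZ_gate.
Qed.

Lemma pushes_C_layer C U : C_layer C -> P_CZ U -> pushes C U.
Proof.
move=> CC; move: C CC U; apply: layer_ind.
- by move=> U dU; exists U; rewrite ?mul1mx ?mulmx1.
- by move=> c Cc U; apply: pushes_CNOT_gate.
(* [W] is performed last, so [U] crosses it first; the resulting [U1] then crosses [V], which is why
   [U] is generalized in the induction. *)
move=> V W pV pW U /pW[U1 /pV[U2 dU2 eqU2] eqU1]; exists U2 => //.
by rewrite mulmxA eqU1 -mulmxA eqU2 mulmxA.
Qed.

(** Induction peels off the first block [V], [C1]: if the rest is [C *m D], moving [D] before [C1]
    gives [C D C1 V = (C C1) (D' V)]. *)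
Lemma layered_PC_normal m U :
  layered (flatten (nseq m [:: @P_layer R n; @C_layer R n])) U ->
  exists D C, [/\ P_CZ D, C_layer C & U = C *m D].
Proof.
elim: m U => [|m IH] U /=.
  move=> ->; exists 1%:M, 1%:M; rewrite mulmx1.
  by split=> //; [apply/P_CZ_of_P/layer_id | apply: layer_id].
move=> [V [_ [PV [C1 [W [CC1 /IH[D [C [dD CC ->]]] ->]]] ->]]].
have [D' dD' eqD] := pushes_C_layer CC1 dD.
exists (D' *m V), (C *m C1); split.
- by apply: P_CZ_mul => //; apply: P_CZ_of_P.
- exact: layer_mul.
by rewrite -(mulmxA C) eqD !mulmxA.
Qed.

End Layers.

Theorem theorem2 (R : realType) (n m : nat) (hn : 0 < n) (hm : 0 < m)
    (U : qop R n) :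
  layered (flatten (nseq m [:: @P_layer R n; @C_layer R n])) U ->
  layered [:: @P_layer R n; @CZ_layer R n; @C_layer R n] U.
Proof.
move=> /layered_PC_normal[_ [C [[V [W [PV ZW ->]]] CC ->]]].
exists V, (C *m W)%R; split=> //; last by rewrite mulmxA.
exists W, C; split=> //.
(* The identity stands for the empty list of layers after the last one. *)
by exists C, (1%:M)%R; rewrite mul1mx.
Qed.
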